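(* Let $V_0:S\to[0,\infty)$ be arbitrary and let $V_n=BV_{n-1}$, $n\ge 1$, be the iterates of the Value Iteration Algorithm, where $$(BV)(s)=\sup_{a\in A(s)}\bigl[r(s,a)+\gamma\,\varsigma\bigl(V(T(s,a,W))\bigr)\bigr],\qquad s\in S.$$ Then there exists $V_\star$ solving the Bellman equation $$V_\star(s)=\sup_{a\in A(s)}\bigl[r(s,a)+\gamma\,\varsigma\bigl(V_\star(T(s,a,W))\bigr)\bigr],\qquad s\in S,$$ and $$\|V_n-V_\star\|_\infty\le\frac{\gamma^n}{1-\gamma}\,\|V_1-V_0\|_\infty$$ for any $n$.
   Context: Setting. $S$ is a complete state space, $A$ is a (measurable) action space, and $X$ is a measurable space. $T:S\times A\times X\to S$ is a measurable mapping. The noise $W_t\in X$ is a Markov stochastic process, which may be assumed to be i.i.d. uniform on $[0,1]$; $W$ denotes a random element with this common distribution. $A(\cdot)$ is a set mapping assigning to each $s\in S$ a set $A(s)\subseteq A$ of admissible actions. $r$ is a uniformly bounded non-negative function of $(s,a)\in S\times A$. $\gamma<1$ is a discount factor. $\|V\|_\infty=\sup_{s\in S}|V(s)|$ is the sup norm. Risk measure. $\mathcal{M}$ is a deterministic risk envelope, i.e. a set of probability densities $Q\in L_2([0,1])$, $Q\ge 0$, $\int_0^1Q(x)\,dx=1$, giving the dual representation of a coherent risk measure. For a probability distribution $\mu$ on $\mathbb{R}$ with quantile function $q_\mu$ put $\Sigma(\mu)=\sup_{Q\in\mathcal{M}}\int_0^1 q_\mu(x)Q(x)\,dx$, and for a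 random variable $Y$ with law $\mathcal{L}(Y)$ put $\sigma(Y)=\Sigma(\mathcal{L}(Y))$. The risk measure $\sigma$ is coherent (monotone, sub-additive, translation invariant: $\sigma(Y+c)=\sigma(Y)+c$ for constants $c$, and positively homogeneous: $\sigma(\lambda Y)=\lambda\sigma(Y)$ for constants $\lambda\ge0$) and support-bounded ($\operatorname{ess\,inf}Y\le\sigma(Y)\le\operatorname{ess\,sup}Y$ for every $Y\in L_2$). Finally $\varsigma(Y)=-\sigma(-Y)$. *)

(* Defs.v *)
From HB Require Import structures.
From mathcomp Require Import all_boot all_order all_algebra.
From mathcomp Require Import all_classical all_reals all_analysis.
From mathcomp Require Import measurable_realfun.

Set Implicit Arguments.
Unset Strict Implicit.
Unset Printing Implicit Defensive.

Import Order.TTheory GRing.Theory Num.Theory.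
Import numFieldNormedType.Exports.

Local Open Scope classical_set_scope.
Local Open Scope ring_scope.
Local Open Scope ereal_scope.

Notation borelType S := (g_sigma_algebraType (@open S)).

(* Value functions may be extended-real valued: Bellman iterates of an unbounded
   function can be infinite. *)
Definition sup_norm (R : realType) (S : Type) (V : S -> \bar R) : \bar R :=
  ereal_sup [set `|V s| | s in [set: S]].

(* Elements of L_2([0,1]) are represented by functions on R; only their values
   on [0,1] matter. *)
Definition density01 (R : realType) : set (R -> R) :=
  [set Q | [/\ Q \in Lfun (mrestr (@lebesgue_measure R)
                             (measurable_itv `[0%R, 1%R])) 2%:E,
               (forall u, (0 <= u <= 1)%R -> (0 <= Q u)%R) &
               \int[@lebesgue_measure R]_(u in `[0%R, 1%R]) (Q u)%:E = 1]].

Definition quantile (R : realType) (mu : set (\bar R) -> \bar R) (u : R) : \bar R :=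
  ereal_inf [set x%:E | x in [set x : R | u%:E <= mu [set y | y <= x%:E]]].

Definition Sigma (R : realType) (M : set (R -> R))
    (mu : set (\bar R) -> \bar R) : \bar R :=
  ereal_sup [set \int[@lebesgue_measure R]_(u in `[0%R, 1%R])
                    (quantile mu u * (Q u)%:E) | Q in M].

(* The outer measure of P makes the law meaningful for every Y, since the
   supremum in the Bellman operator need not preserve measurability. It is the
   usual law for measurable Y, see lawE. *)
Definition law (R : realType) (d : measure_display) (Omega : measurableType d)
    (P : probability Omega R) (Y : Omega -> \bar R) : set (\bar R) -> \bar R :=
  fun B => mu_ext P (Y @^-1` B).

Lemma lawE (R : realType) (d : measure_display) (Omega : measurableType d)
    (P : probability Omega R) (Y : Omega -> \bar R) (B : set (\bar R)) :
  measurable_fun [set: Omega] Y -> measurable B ->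
  law P Y B = P (Y @^-1` B).
Proof.
move=> mY mB; rewrite /law measurable_mu_extE//.
by rewrite -[X in measurable X]setTI; exact: mY.
Qed.

Definition sigma (R : realType) (M : set (R -> R)) (d : measure_display)
    (Omega : measurableType d) (P : probability Omega R)
    (Y : Omega -> \bar R) : \bar R :=
  Sigma M (law P Y).

Definition varsigma (R : realType) (M : set (R -> R)) (d : measure_display)
    (Omega : measurableType d) (P : probability Omega R)
    (Y : Omega -> \bar R) : \bar R :=
  - sigma M P (fun w => - Y w).

Definition bellman (R : realType) (S A X : Type) (M : set (R -> R))
    (d : measure_display) (Omega : measurableType d) (P : probability Omega R)
    (W : Omega -> X) (T : S * A * X -> S) (Adm : S -> set A) (r : S * A -> R)
    (gamma : R) (V : S -> \bar R) (s : S) : \bar R :=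
  ereal_sup [set (r (s, a))%:E +
                 gamma%:E * varsigma M P (fun w => V (T (s, a, W w)))
            | a in Adm s].

(* Main.v *)
(* The value iterates satisfy |V_{n+1} - V_n| <= gamma^n delta with
   delta = ||V_1 - V_0||, because 0 <= U <= V + c implies B U <= B V + gamma c:
   the quantile, hence the risk of the nonpositive variable -V, shifts with
   constants, even for laws built from an outer measure.
   With e_n = gamma^n / (1 - gamma) delta, the sequence V_n - e_n is
   nondecreasing and V_n + e_n is nonincreasing, so V_* = sup_n (V_n - e_n) is
   within e_n of V_n, and B V_* is then within 2 e_n of V_* for every n.
   The operator B may have several unbounded fixed points, so V_* has to be
   built from V_0; only when ||V_1 - V_0|| is infinite is it built from 0, in
   which case the bound is trivial unless gamma = 0. *)
Require Import Defs.
From mathcomp Require Import all_boot all_order all_algebra.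
From mathcomp Require Import all_classical all_reals all_analysis.
From mathcomp Require Import measurable_realfun.
From mathcomp Require Import ring lra.
Import Order.TTheory GRing.Theory Num.Theory.
Import numFieldNormedType.Exports.
Local Open Scope classical_set_scope.
Local Open Scope ring_scope.
Local Open Scope ereal_scope.

Set Implicit Arguments.
Unset Strict Implicit.
Unset Printing Implicit Defensive.

(** * Measurability of quantile functions and densities *)

Lemma nondecreasing_emeasurable (R : realType) (D : set R) (f : R -> \bar R) :
  measurable D -> {homo f : x y / (x <= y)%R >-> x <= y} -> measurable_fun D f.
Proof.
move=> mD f_nd _; apply: (measurability _ (ErealGenCInfty.measurableE R)) => //.
(* By monotonicity the preimage of an upper ray is upward closed, hence an interval. *)
move=> _ [_ [x ->] <-]; apply: measurableI => //.
apply: is_interval_measurable => u v /=; rewrite !in_itv/= !andbT.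
move=> xu _ w /andP[uw _]; rewrite in_itv/= andbT.
exact: le_trans xu (f_nd _ _ uw).
Qed.

Lemma quantile_nondecreasing (R : realType) (mu : set (\bar R) -> \bar R) :
  {homo quantile mu : u v / (u <= v)%R >-> u <= v}.
Proof.
move=> u v uv; apply/ereal_infP => _ [x /= xv <-].
apply: ereal_inf_lbound; exists x => //=.
by apply: le_trans xv; rewrite lee_fin.
Qed.

Lemma density01_measurable (R : realType) (Q : R -> R) :
  density01 Q -> measurable_fun [set: R] Q.
Proof. by case=> /sub_Lfun_mfun/set_mem. Qed.

(** * Sign and shift estimates for the risk measure *)

Section risk.
Context {R : realType} {d : measure_display} {Omega : measurableType d}.
Context {P : probability Omega R}.
Implicit Types Y Z : Omega -> \bar R.

Lemma mu_ext_probability_setT : mu_ext P [set: Omega] = 1.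
Proof. by rewrite measurable_mu_extE//; exact: probability_setT. Qed.

Lemma quantile_law_le0 Y (u : R) : (forall w, Y w <= 0) -> (u <= 1)%R ->
  quantile (law P Y) u <= 0.
Proof.
move=> Y0 u1; apply: ereal_inf_lbound; exists 0%R => //=.
rewrite /law (_ : _ @^-1` _ = setT).
  by rewrite mu_ext_probability_setT lee_fin.
by apply/seteqP; split=> // w _ /=; exact: Y0.
Qed.

(** No negative threshold carries positive mass. The level [u = 0] has to be excluded: every real
    threshold is admissible there and the quantile is -oo. *)
Lemma quantile_law_ge0 Y (u : R) : (forall w, 0 <= Y w) -> (0 < u)%R ->
  0 <= quantile (law P Y) u.
Proof.
move=> Y0 u0; apply/ereal_infP => _ [x /= ux <-]; rewrite leNgt; apply/negP.
move=> x0; move: ux; rewrite /law (_ : _ @^-1` _ = set0).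
  by rewrite measurable_mu_extE// measure0 lee_fin leNgt u0.
rewrite -subset0 => w /= Yx; have := le_lt_trans (le_trans (Y0 w) Yx) x0.
by rewrite ltxx.
Qed.

(** The event [Y <= x] is contained in [Z <= x + c]. Monotonicity of the outer measure then
    suffices, so [Y] and [Z] may be non-measurable. *)
Lemma quantile_lawD Y Z (c u : R) : (forall w, Z w <= Y w + c%:E) ->
  quantile (law P Z) u <= quantile (law P Y) u + c%:E.
Proof.
move=> ZY; rewrite -leeBlDr//; apply/ereal_infP => _ [x ux <-].
rewrite leeBlDr//; apply: ereal_inf_lbound; exists (x + c)%R => //.
apply: le_trans ux _; apply: le_mu_ext => w /= Yx.
by apply: le_trans (ZY w) _; rewrite EFinD leeD2r.
Qed.

Variables (M : set (R -> R)).
Hypotheses (M0 : M !=set0) (Mdensity : M `<=` @density01 R).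

Local Notation I01 := (`[0%R, 1%R]%classic : set R).

Lemma measurable_quantileM Q mu :
  M Q -> measurable_fun I01 (fun u => quantile mu u * (Q u)%:E).
Proof.
move=> MQ; apply: emeasurable_funM.
  by apply: nondecreasing_emeasurable => //; exact: quantile_nondecreasing.
apply/measurable_EFinP; apply: measurable_funTS.
exact: density01_measurable (Mdensity MQ).
Qed.

Lemma density_ge0 Q u : M Q -> I01 u -> (0 <= Q u)%R.
Proof.
by move=> /Mdensity[_ Q0 _]; rewrite /= in_itv/=; exact: Q0.
Qed.

Lemma quantileM_le0 Y Q u : M Q -> (forall w, Y w <= 0) -> I01 u ->
  quantile (law P Y) u * (Q u)%:E <= 0.
Proof.
move=> MQ Y0 u01; rewrite mule_le0_ge0//; last exact/density_ge0.
by apply: quantile_law_le0 => //; move: u01; rewrite /= in_itv/= => /andP[].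
Qed.

(** Passing to a nonnegative integrand gives access to monotonicity and additivity of the integral
    without integrability. *)
Lemma integral_quantile_law_le0 Y Q : M Q -> (forall w, Y w <= 0) ->
  \int[lebesgue_measure]_(u in I01) (quantile (law P Y) u * (Q u)%:E) =
  - \int[lebesgue_measure]_(u in I01) (- (quantile (law P Y) u * (Q u)%:E)).
Proof.
move=> MQ Y0; rewrite -integral_ge0N.
  by apply: eq_integral => u _; rewrite oppeK.
by move=> u u01; rewrite oppe_ge0 quantileM_le0.
Qed.

Lemma sigma_le0 Y : (forall w, Y w <= 0) -> sigma M P Y <= 0.
Proof.
move=> Y0; apply/ereal_supP => _ [Q MQ <-].
rewrite integral_quantile_law_le0// oppe_le0.
by apply: integral_ge0 => u u01; rewrite oppe_ge0 quantileM_le0.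
Qed.

Lemma sigma_ge0 Y : (forall w, 0 <= Y w) -> 0 <= sigma M P Y.
Proof.
move=> Y0; have [Q MQ] := M0.
apply: (@le_trans _ _ (\int[lebesgue_measure]_(u in I01)
    (quantile (law P Y) u * (Q u)%:E))); last first.
  by apply: ereal_sup_ubound; exists Q.
(* The endpoint 0, where the quantile is -oo, is removed as a null set. *)
rewrite -integral_itv_obnd_cbnd; last first.
  apply: (measurable_funS _ _ (measurable_quantileM (law P Y) MQ)) => //.
  exact: subset_itv_oc_cc.
apply: integral_ge0 => u /=; rewrite in_itv/= => /andP[u0 u1].
rewrite mule_ge0 ?quantile_law_ge0// lee_fin (density_ge0 MQ)//.
by rewrite /= in_itv/= ltW.
Qed.

(** For each density the quantiles differ by at most [c], and integrating this against mass 1 keeps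
    the constant [c]. *)
Lemma le_sigmaD Y Z c : (0 <= c)%R ->
  (forall w, Y w <= 0) -> (forall w, Z w <= 0) ->
  (forall w, Y w <= Z w + c%:E) -> sigma M P Y <= sigma M P Z + c%:E.
Proof.
move=> c0 Y0 Z0 YZ; apply/ereal_supP => _ [Q MQ <-].
apply: (@le_trans _ _ (\int[lebesgue_measure]_(u in I01)
    (quantile (law P Z) u * (Q u)%:E) + c%:E)); last first.
  by rewrite leeD2r//; apply: ereal_sup_ubound; exists Q.
rewrite !integral_quantile_law_le0//.
rewrite leeNl fin_num_oppeD// oppeK leeBlDr//.
have [_ _ Q1] := Mdensity MQ.
have mQ : measurable_fun I01 (EFin \o Q).
  apply/measurable_EFinP; apply: measurable_funTS.
  exact: density01_measurable (Mdensity MQ).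
(* The constant becomes an integral against [Q], so that the comparison reduces to a pointwise
   one. *)
have cE : c%:E = \int[lebesgue_measure]_(u in I01) (c%:E * (Q u)%:E).
  rewrite ge0_integralZl_EFin// ?Q1 ?mule1// => u u01.
  by rewrite lee_fin density_ge0.
rewrite [X in _ + X]cE -ge0_integralD//=.
- apply: ge0_le_integral => //=.
  + by move=> u u01; rewrite oppe_ge0 quantileM_le0.
  + by apply: measurableT_comp => //; exact: measurable_quantileM.
  + apply: emeasurable_funD; last exact: measurable_funeM.
    by apply: measurableT_comp => //; exact: measurable_quantileM.
  + move=> u u01; rewrite -!mulNe -muleDl ?fin_num_adde_defl//.
    rewrite lee_wpmul2r ?lee_fin ?density_ge0//.
    rewrite leeNl fin_num_oppeD// oppeK leeBlDr//.
    exact: quantile_lawD.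
- by move=> u u01; rewrite oppe_ge0 quantileM_le0.
- by apply: measurableT_comp => //; exact: measurable_quantileM.
- by move=> u u01; rewrite mule_ge0// lee_fin density_ge0.
- exact: measurable_funeM.
Qed.

Lemma varsigma_ge0 Y : (forall w, 0 <= Y w) -> 0 <= varsigma M P Y.
Proof.
by move=> Y0; rewrite oppe_ge0 sigma_le0// => w; rewrite oppe_le0.
Qed.

Lemma varsigma0_le0 : varsigma M P (fun=> 0) <= 0.
Proof. by rewrite oppe_le0 sigma_ge0// => w; rewrite oppe0. Qed.

Lemma le_varsigmaD Y Z c : (0 <= c)%R ->
  (forall w, 0 <= Y w) -> (forall w, 0 <= Z w) ->
  (forall w, Y w <= Z w + c%:E) -> varsigma M P Y <= varsigma M P Z + c%:E.
Proof.
move=> c0 Y0 Z0 YZ; rewrite leeNl fin_num_oppeD// oppeK leeBlDr//.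
apply: le_sigmaD => // w; rewrite ?oppe_le0//.
by rewrite leeNl fin_num_oppeD// oppeK leeBlDr.
Qed.
End risk.

(** * The Bellman operator on nonnegative functions *)

Section bellman_operator.
Context {R : realType} {S A X : Type} {d : measure_display}.
Context {Omega : measurableType d} {P : probability Omega R}.
Variables (M : set (R -> R)) (W : Omega -> X) (T : S * A * X -> S).
Variables (Adm : S -> set A) (r : S * A -> R) (gamma : R).
Hypotheses (M0 : M !=set0) (Mdensity : M `<=` @density01 R).
Hypotheses (Adm0 : forall s, Adm s !=set0) (gamma_ge0 : (0 <= gamma)%R).
Hypothesis r_ge0 : forall z, (0 <= r z)%R.
Local Notation B := (bellman M P W T Adm r gamma).

Lemma bellman_ge0 (V : S -> \bar R) s : (forall s, 0 <= V s) -> 0 <= B V s.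
Proof.
(* One admissible action keeps the supremum from being that of the empty set, -oo. *)
move=> V0; have [a Aa] := Adm0 s.
apply: le_trans (ereal_sup_ubound (ex_intro2 _ _ a Aa erefl)).
by rewrite adde_ge0 ?mule_ge0 ?lee_fin// varsigma_ge0.
Qed.

(** The two suprema are compared action by action, and discounting shrinks the shift. This one-sided
    form avoids subtracting possibly infinite values. *)
Lemma le_bellmanD (U V : S -> \bar R) (c : R) s : (0 <= c)%R ->
  (forall s, 0 <= U s) -> (forall s, 0 <= V s) ->
  (forall s, U s <= V s + c%:E) -> B U s <= B V s + (gamma * c)%:E.
Proof.
move=> c0 U0 V0 UV; apply/ereal_supP => _ [a Aa <-].
apply: le_trans (leeD2r _ (ereal_sup_ubound (ex_intro2 _ _ a Aa erefl))).
rewrite -addeA leeD2l// EFinM -muleDr// ?fin_num_adde_defl//.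
by rewrite lee_wpmul2l ?lee_fin//; exact: le_varsigmaD.
Qed.

Lemma bellman0_le (C : R) s : (forall z, (r z <= C)%R) -> B (fun=> 0) s <= C%:E.
Proof.
move=> rC; apply/ereal_supP => _ [a Aa <-].
rewrite -[leRHS]adde0 leeD ?lee_fin//.
by rewrite mule_ge0_le0 ?lee_fin ?varsigma0_le0.
Qed.

Lemma bellman_discount0 (U : S -> \bar R) s : gamma = 0%R ->
  B U s = ereal_sup [set (r (s, a))%:E | a in Adm s].
Proof.
move=> gamma0; apply: (congr1 (@ereal_sup R)).
by apply: eq_imagel => a _; rewrite gamma0 mul0e adde0.
Qed.
End bellman_operator.

(** Kept abstract in [B] and [V0] because it is started both from the given function and from 0. The
    pointwise convergence serves the measurability of the limit. *)
Lemma contraction_fixpoint (R : realType) (S : Type)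
    (B : (S -> \bar R) -> S -> \bar R) (gamma delta : R) (V0 : S -> R) :
    (0 <= gamma < 1)%R -> (0 <= delta)%R ->
    (forall U s, (forall s, 0 <= U s) -> 0 <= B U s) ->
    (forall U V c s, (0 <= c)%R -> (forall s, 0 <= U s) ->
      (forall s, 0 <= V s) -> (forall s, U s <= V s + c%:E) ->
      B U s <= B V s + (gamma * c)%:E) ->
    (forall s, (0 <= V0 s)%R) ->
    (forall s, `|B (EFin \o V0) s - (V0 s)%:E| <= delta%:E) ->
  exists Vstar : S -> R,
    [/\ forall s, (0 <= Vstar s)%R,
        forall s, (Vstar s)%:E = B (EFin \o Vstar) s,
        forall n s, `|iter n B (EFin \o V0) s - (Vstar s)%:E| <=
          (gamma ^+ n / (1 - gamma) * delta)%:E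
      & forall s, iter n B (EFin \o V0) s @[n --> \oo] --> (Vstar s)%:E].
Proof.
move=> /andP[gamma0 gamma1] delta0 B_ge0 BD V0_ge0 V01.
set V := fun n => iter n B (EFin \o V0).
have V_ge0 n s : 0 <= V n s.
  elim: n s => [s|n IHn s]; first by rewrite lee_fin.
  exact: B_ge0.
have gn_ge0 n : (0 <= gamma ^+ n * delta)%R by rewrite mulr_ge0 ?exprn_ge0.
(* Two one-sided bounds are carried through the induction, since finiteness of the iterates is only
   deduced from them afterwards. *)
have V_step n s : V n.+1 s <= V n s + (gamma ^+ n * delta)%:E /\
    V n s <= V n.+1 s + (gamma ^+ n * delta)%:E.
  elim: n s => [s|n IHn s].
    rewrite expr0 mul1r /V/=; have := V01 s.
    case: (B _ s) => [x||]//=; rewrite -!EFinD !lee_fin ler_norml.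
    by move=> /andP[? ?]; split; lra.
  rewrite exprS -mulrA; split.
    by apply: (BD (V n.+1) (V n)) => // t; have [] := IHn t.
  by apply: (BD (V n) (V n.+1)) => // t; have [] := IHn t.
have V_fin n s : V n s \is a fin_num.
  elim: n => [//|n IHn]; rewrite ge0_fin_numE//.
  apply: le_lt_trans (V_step n s).1 _.
  by rewrite lte_add_pinfty ?ltry// -ge0_fin_numE.
pose v n s := fine (V n s).
have vE n s : V n s = (v n s)%:E by rewrite fineK.
have v_step n s : (v n.+1 s <= v n s + gamma ^+ n * delta)%R /\
    (v n s <= v n.+1 s + gamma ^+ n * delta)%R.
  by have := V_step n s; rewrite !vE -!EFinD !lee_fin.
(* The tail of the geometric series: the sum of [gamma ^+ k * delta] over [k >= n]. *)
pose e n := (gamma ^+ n / (1 - gamma) * delta)%R.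
have e_step n : (e n = gamma ^+ n * delta + e n.+1)%R.
  by rewrite /e exprS; field; rewrite subr_eq0 gt_eqF.
have eS n : e n.+1 = (gamma * e n)%R by rewrite /e exprS -!mulrA.
have e_ge0 n : (0 <= e n)%R.
  by rewrite /e mulr_ge0// divr_ge0 ?exprn_ge0// subr_ge0 ltW.
have e_cvg0 : e n @[n --> \oo] --> 0%R.
  rewrite (_ : e = geometric (delta / (1 - gamma)) gamma); last first.
    by apply/funext => n; rewrite /e/= -mulrA mulrC (mulrC delta).
  by apply: cvg_geometric; rewrite ger0_norm.
have le_e (x y : R) : (forall n, x <= y + 2 * e n)%R -> (x <= y)%R.
  move=> xy; apply/ler_addgt0Pr => eps eps0.
  have /cvgrPdist_lt/(_ (eps / 2)%R) := e_cvg0.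
  rewrite divr_gt0// => /(_ erefl)[n _ /(_ n (leqnn n))].
  rewrite sub0r normrN ger0_norm// => en.
  by apply: le_trans (xy n) _; lra.
have lo_nd s :
    {homo (fun n => v n s - e n)%R : m n / (m <= n)%N >-> (m <= n)%R}.
  apply/nondecreasing_seqP => n; have [? ?] := v_step n s.
  by rewrite (e_step n); lra.
have hi_ni s :
    {homo (fun n => v n s + e n)%R : m n / (m <= n)%N >-> (n <= m)%R}.
  apply/nonincreasing_seqP => n; have [? ?] := v_step n s.
  by rewrite (e_step n); lra.
(* Both sides are moved to the common index [maxn m n]. This bounds the set below [sup], whose value
   would otherwise be a default. *)
have lo_hi s m n : (v m s - e m <= v n s + e n)%R.
  apply: le_trans (lo_nd s _ _ (leq_maxl m n)) _.
  apply: le_trans (hi_ni s _ _ (leq_maxr m n)).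
  by have := e_ge0 (maxn m n); lra.
pose Vs s := sup (range (fun n => v n s - e n)%R).
have Vs_ge n s : (v n s - e n <= Vs s)%R.
  apply: ub_le_sup; last by exists n.
  by exists (v 0%N s + e 0%N)%R => _ [m _ <-]; exact: lo_hi.
have Vs_le n s : (Vs s <= v n s + e n)%R.
  apply: ge_sup; first by exists (v 0%N s - e 0%N)%R, 0%N.
  by move=> _ [m _ <-]; exact: lo_hi.
have Vs_ge0 s : (0 <= Vs s)%R.
  apply: le_e => n; have := V_ge0 n s; have := e_ge0 n; have := Vs_ge n s.
  by rewrite vE lee_fin; lra.
exists Vs; split => //.
- move=> s.
  (* [Vs] is within [e n] of [V n], so applying [B] gives distance at most [gamma * e n], which is
     [e n.+1]. *)
  have BV n : B (EFin \o Vs) s <= V n.+1 s + (e n.+1)%:E.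
    rewrite eS; apply: (BD (EFin \o Vs) (V n)) => // t.
    by rewrite vE -EFinD lee_fin.
  have VB n : V n.+1 s <= B (EFin \o Vs) s + (e n.+1)%:E.
    rewrite eS; apply: (BD (V n) (EFin \o Vs)) => // t.
    by rewrite vE -EFinD lee_fin; have := Vs_ge n t; lra.
  have Bfin : B (EFin \o Vs) s \is a fin_num.
    rewrite ge0_fin_numE; last by apply: B_ge0 => t; rewrite lee_fin.
    by apply: le_lt_trans (BV 0%N) _; rewrite vE -EFinD ltry.
  rewrite -(fineK Bfin) in BV VB *; congr (_%:E); apply/eqP.
  (* Going through [V n.+1] costs [2 * e n.+1], which is at most [2 * e n]. *)
  rewrite eq_le; apply/andP; split; apply: le_e => n.
    have := VB n; have := Vs_le n.+1 s; have [? ?] := v_step n s.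
    have := e_step n; have := gn_ge0 n; rewrite vE -EFinD lee_fin; lra.
  have := BV n; have := Vs_ge n.+1 s; have [? ?] := v_step n s.
  have := e_step n; have := gn_ge0 n; rewrite vE -EFinD lee_fin; lra.
- move=> n s; rewrite -/(V n s) vE -EFinB lee_fin ler_distl.
  by have := Vs_ge n s; have := Vs_le n s; rewrite /e; lra.
- move=> s; rewrite (_ : (fun n => _) = EFin \o v^~ s); last first.
    by apply/funext => n /=; rewrite -vE.
  apply: cvg_EFin; first by near=> n.
  apply: (@squeeze_cvgr _ _ _ _ (fun n => Vs s - e n)%R (fun n => Vs s + e n)%R).
  + near=> n; have := Vs_ge n s; have := Vs_le n s; rewrite /=; lra.
  + by rewrite -[X in _ --> X]subr0; apply: cvgB => //; exact: cvg_cst.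
  + by rewrite -[X in _ --> X]addr0; apply: cvgD => //; exact: cvg_cst.
Unshelve. all: by end_near. Qed.

(** * Choice of the starting point, error bound and measurability *)

Theorem theorem3 (R : realType) (S : completePseudoMetricType R)
    (dA dX dO : measure_display) (A : measurableType dA) (X : measurableType dX)
    (Omega : measurableType dO) (P : probability Omega R) (W : {RV P >-> X})
    (T : borelType S * A * X -> borelType S)
    (hT : measurable_fun [set: borelType S * A * X] T)
    (Adm : S -> set A) (hAdm : forall s : S, Adm s !=set0)
    (r : S * A -> R)
    (hr : exists C : R, forall z : S * A, (0 <= r z <= C)%R)
    (gamma : R) (hgamma : (0 <= gamma < 1)%R)
    (M : set (R -> R)) (hM0 : M !=set0) (hM : M `<=` @density01 R)
    (V0 : S -> R) (hV0 : forall s : S, (0 <= V0 s)%R) :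
  let B := @bellman R S A X M dO Omega P W T Adm r gamma in
  let V := fun n : nat => iter n B (EFin \o V0) in
  exists Vstar : S -> R,
    [/\ forall s : S, (0 <= Vstar s)%R,
        forall s : S, (Vstar s)%:E = B (EFin \o Vstar) s,
        forall n : nat,
          sup_norm (fun s => V n s - (Vstar s)%:E) <=
          (gamma ^+ n / (1 - gamma))%:E * sup_norm (fun s => V 1%N s - V 0%N s)
      & (forall U : S -> \bar R, (forall s : S, 0 <= U s) ->
           measurable_fun [set: borelType S] U ->
           measurable_fun [set: borelType S] (B U)) ->
        measurable_fun [set: borelType S] V0 ->
        measurable_fun [set: borelType S] Vstar].
Proof.
move=> B V; have [gamma0 gamma1] := andP hgamma.
(* The maximum makes the bound nonnegative without picking a point of [S * A]. *)
have [C hC] := hr; pose C' := Num.max C 0%R.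
have r_ge0 z : (0 <= r z)%R by have /andP[] := hC z.
have r_le z : (r z <= C')%R by have /andP[_ rC] := hC z; rewrite le_max rC.
have B_ge0 U s : (forall s, 0 <= U s) -> 0 <= B U s.
  by move=> U0; exact: bellman_ge0.
have BD U1 U2 c s : (0 <= c)%R -> (forall s, 0 <= U1 s) ->
    (forall s, 0 <= U2 s) -> (forall s, U1 s <= U2 s + c%:E) ->
    B U1 s <= B U2 s + (gamma * c)%:E.
  by move=> *; exact: le_bellmanD.
have iter_ge0 (U : S -> R) n s : (forall s, (0 <= U s)%R) ->
    0 <= iter n B (EFin \o U) s.
  by move=> U0; elim: n s => [s|n IHn s]; [rewrite lee_fin|exact: B_ge0].
have lim_measurable (U Vs : S -> R) : (forall s, (0 <= U s)%R) ->
    (forall s, iter n B (EFin \o U) s @[n --> \oo] --> (Vs s)%:E) ->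
    (forall U : S -> \bar R, (forall s : S, 0 <= U s) ->
      measurable_fun [set: borelType S] U ->
      measurable_fun [set: borelType S] (B U)) ->
    measurable_fun [set: borelType S] U ->
    measurable_fun [set: borelType S] Vs.
  move=> U0 UVs mB mU; apply/measurable_EFinP.
  apply: (@emeasurable_fun_cvg _ (borelType S) _ _
    (fun n => iter n B (EFin \o U))) => [n|s _]; last exact: UVs.
  elim: n => [|n IHn]; first exact/measurable_EFinP.
  by apply: mB => // s; exact: iter_ge0.
set D := sup_norm (fun s => V 1%N s - V 0%N s).
have V01_le s : `|V 1%N s - V 0%N s| <= D by apply: ereal_sup_ubound; exists s.
have [/andP[D0 Dfin]|Dfin] := boolP ((0 <= D) && (D \is a fin_num)).
  have V01 s : `|B (EFin \o V0) s - (V0 s)%:E| <= (fine D)%:E.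
    by rewrite fineK//; exact: V01_le.
  have [Vs [Vs0 VsB Vsle Vscvg]] :=
    contraction_fixpoint hgamma (fine_ge0 D0) B_ge0 BD hV0 V01.
  exists Vs; split => //; last by move=> mB mV0; exact: lim_measurable mB mV0.
  move=> n; apply: ge_ereal_sup => _ [s _ <-].
  by rewrite -(fineK Dfin) -EFinM; exact: Vsle.
have C'0 : (0 <= C')%R by rewrite le_max lexx orbT.
have B0_le s : `|B (EFin \o cst 0%R) s - 0%:E| <= C'%:E.
  rewrite sube0 gee0_abs; last by apply: B_ge0 => t; rewrite lee_fin.
  exact: bellman0_le.
have [Vs [Vs0 VsB _ Vscvg]] :=
  contraction_fixpoint hgamma C'0 B_ge0 BD (fun=> lexx 0%R) B0_le.
exists Vs; split => //; last first.
  by move=> mB _; exact: (lim_measurable (cst 0%R)).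
move=> n; apply: ge_ereal_sup => _ [s _ <-].
have Dy : D = +oo.
  have D0 : 0 <= D := le_trans (abse_ge0 _) (V01_le s).
  by move: Dfin D0; rewrite /D; case: sup_norm => //= x; rewrite andbT => /negP.
(* A positive coefficient times +oo makes the bound trivial. Otherwise [gamma = 0] and [n > 0], the
   right side is 0, and [V n] must equal [Vs] exactly. *)
have [coef_gt0|] := ltP 0%R (gamma ^+ n / (1 - gamma))%R.
  by rewrite Dy gt0_muley ?lte_fin// leey.
rewrite pmulr_lle0 ?invr_gt0 ?subr_gt0// => gn_le0.
have : (gamma ^+ n == 0)%R by rewrite eq_le gn_le0 exprn_ge0.
rewrite expf_eq0 => /andP[n_gt0 /eqP g0].
rewrite (_ : V n s = (Vs s)%:E).
  by rewrite subee// abse0 g0 expr0n gtn_eqF// mul0r mul0e.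
(* Without discount [B] is a constant map, so its value at the previous iterate is already its fixed
   point. *)
have BE U := @bellman_discount0 R S A X dO Omega P M W T Adm r gamma U s g0.
rewrite -(prednK n_gt0).
exact: etrans (BE (V n.-1)) (esym (etrans (VsB s) (BE (EFin \o Vs)))).
Qed.
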